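(* (Valve manifold model.) Consider the interconnection of Tank 1, two middle pipe sections $i=1,2$, and Tank 2, whose signals are real-valued functions of time, differentiable where a derivative appears, satisfying: (Tank 1) $\dot p_{T_1}=\alpha_{T_1}(q_{T_1,\ell}-q_{T_1,1,r}-q_{T_1,2,r})$ with linearized inlet orifice relation $q_{T_1,\ell}=\xi_{T_1}p_{T_1}+\zeta_{T_1}p_{T_1,\ell}$; (middle sections) $\dot p_{i,r}=\alpha_i(q_{i,r}-q_{i,\ell})$ and $\dot q_{i,\ell}=\beta_ip_{i,r}+\kappa_ip_{i,\ell}+\gamma_iq_{i,\ell}$ for $i=1,2$; (Tank 2) $\dot p_{T_2}=\alpha_{T_2}(q_{T_2,1,\ell}+q_{T_2,2,\ell}-q_{T_2,r})$ with linearized inlet orifice relations $q_{T_2,i,\ell}=\xi_{T_2}p_{T_2}+\zeta_{T_2}p_{T_2,i,\ell}$ for $i=1,2$; (boundary conditions) $p_{i,\ell}=p_{T_1}$, $q_{T_1,i,r}=q_{i,\ell}$, $p_{T_2,i,\ell}=p_{i,r}$, $q_{i,r}=q_{T_2,i,\ell}$ for $i=1,2$. Put $x=\begin{bmatrix}p_{T_1}&p_{1,r}&q_{1,\ell}&p_{2,r}&q_{2,\ell}&p_{T_2}\end{bmatrix}^\top$, $y=\begin{bmatrix}p_{T_2}&q_{T_1,\ell}\end{bmatrix}^\top$, $u=\begin{bmatrix}p_{T_1,\ell}&q_{T_2,r}\end{bmatrix}^\top$. Then $$\dot x=\begin{bmatrix}\alpha_{T_1}\xi_{T_1}&0&-\alpha_{T_1}&0&-\alpha_{T_1}&0\\0&\alpha_1\zeta_{T_2}&-\alpha_1&0&0&\alpha_1\xi_{T_2}\\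 \kappa_1&\beta_1&\gamma_1&0&0&0\\0&0&0&\alpha_2\zeta_{T_2}&-\alpha_2&\alpha_2\xi_{T_2}\\ \kappa_2&0&0&\beta_2&\gamma_2&0\\0&\alpha_{T_2}\zeta_{T_2}&0&\alpha_{T_2}\zeta_{T_2}&0&2\alpha_{T_2}\xi_{T_2}\end{bmatrix}x+\begin{bmatrix}\alpha_{T_1}\zeta_{T_1}&0\\0&0\\0&0\\0&0\\0&0\\0&-\alpha_{T_2}\end{bmatrix}u,$$ $$y=\begin{bmatrix}0&0&0&0&0&1\\ \xi_{T_1}&0&0&0&0&0\end{bmatrix}x+\begin{bmatrix}0&0\\ \zeta_{T_1}&0\end{bmatrix}u.$$
   Context: All coefficients are real constants. $p_{T_k}$ is the pressure in Tank $k$; $p_{T_1,\ell},q_{T_1,\ell}$ are pressure and mass flow at the inlet of Tank 1, $q_{T_1,i,r}$ is the flow at its $i$-th outlet; $p_{T_2,i,\ell},q_{T_2,i,\ell}$ are pressure and flow at the $i$-th inlet of Tank 2 and $q_{T_2,r}$ is its outlet flow; $p_{i,\ell},p_{i,r},q_{i,\ell},q_{i,r}$ are the pressures and mass flows at the left and right ends of middle section $i$ (a pipe-valve-pipe connection modelled as a single pipe). All signals are deviations from nominal values. $\alpha_{T_k}=R_sz_0T_0/V_{T_k}$ with $V_{T_k}$ the volume of Tank $k$ and $R_s,z_0,T_0>0$; $\xi_{T_k}$ and $\zeta_{T_k}$ are the partial derivatives, at the nominal point, of the inlet orifice mass flow of Tank $k$ with respect to the tank pressure and the upstream pressure; all inlets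 of Tank 2 have identical geometry. *)

(* Defs.v *)
From HB Require Import structures.
From mathcomp Require Import all_boot all_order all_algebra.
From mathcomp Require Import all_classical all_reals all_analysis.

Set Implicit Arguments.
Unset Strict Implicit.
Unset Printing Implicit Defensive.

Import Order.TTheory GRing.Theory Num.Theory numFieldNormedType.Exports.

Local Open Scope ring_scope.

Definition mx_of_rows (R : nzRingType) (m n : nat) (s : seq (seq R)) :
    'M[R]_(m, n) :=
  \matrix_(i, j) nth 0 (nth [::] s i) j.

Definition col_of_seq (R : nzRingType) (n : nat) (s : seq R) : 'cV[R]_n :=
  \col_i nth 0 s i.

(* Both the middle sections and the ports of the tanks are indexed by 'I_2,
   whose elements 0 and 1 stand for the indices 1 and 2. *)
Definition sec1 : 'I_2 := ord0.
Definition sec2 : 'I_2 := ord_max.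

Definition tank_alpha (R : realType) (Rs z0 T0 V : R) : R := Rs * z0 * T0 / V.

(* [m p pu] is the mass flow through the inlet orifice of a tank at pressure
   [p] with upstream pressure [pu]; [xi] and [zeta] are its two partial
   derivatives at the nominal point [(pbar, pubar)]. *)
Definition orifice_coefficients (R : realType) (m : R -> R -> R)
    (pbar pubar xi zeta : R) : Prop :=
  is_derive pbar 1 (fun p : R => m p pubar) xi /\
  is_derive pubar 1 (fun pu : R => m pbar pu) zeta.

(* In the models below, [is_derive t 1 f d] means that [f] is differentiable
   at [t] with derivative [d], and [D] is the set of times considered. *)

Definition tank1_model (R : realType) (D : set R) (alpha xi zeta : R)
    (p pl ql : R -> R) (qr : 'I_2 -> R -> R) : Prop :=
  forall t, D t ->
    is_derive t 1 p (alpha * (ql t - qr sec1 t - qr sec2 t)) /\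
    ql t = xi * p t + zeta * pl t.

Definition middle_section_model (R : realType) (D : set R)
    (alpha beta kappa gamma : R) (pl pr ql qr : R -> R) : Prop :=
  forall t, D t ->
    is_derive t 1 pr (alpha * (qr t - ql t)) /\
    is_derive t 1 ql (beta * pr t + kappa * pl t + gamma * ql t).

Definition tank2_model (R : realType) (D : set R) (alpha xi zeta : R)
    (p qr : R -> R) (pl ql : 'I_2 -> R -> R) : Prop :=
  forall t, D t ->
    is_derive t 1 p (alpha * (ql sec1 t + ql sec2 t - qr t)) /\
    forall i : 'I_2, ql i t = xi * p t + zeta * pl i t.

Definition manifold_boundary_conditions (R : realType) (D : set R)
    (pT1 : R -> R) (qT1r pl pr ql qr pT2l qT2l : 'I_2 -> R -> R) : Prop :=
  forall t, D t -> forall i : 'I_2,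
    [/\ pl i t = pT1 t, qT1r i t = ql i t,
        pT2l i t = pr i t & qr i t = qT2l i t].

(* Main.v *)
Require Import Defs.
From HB Require Import structures.
From mathcomp Require Import all_boot all_order all_algebra.
From mathcomp Require Import all_classical all_reals all_analysis.
From mathcomp Require Import ring.

Set Implicit Arguments.
Unset Strict Implicit.
Unset Printing Implicit Defensive.

Import Order.TTheory GRing.Theory Num.Theory numFieldNormedType.Exports.

Local Open Scope ring_scope.

(** The model is linear, so the proof is an elimination. At each time the boundary conditions
    replace $p_{i,\ell}$, $q_{T_1,i,r}$, $p_{T_2,i,\ell}$ and $q_{i,r}$, and the orifice relations
    replace $q_{T_1,\ell}$ and $q_{T_2,i,\ell}$. Each of the six scalar equations then has a
    right-hand side linear in the entries of $x$ and $u$, whose coefficients form one row of $A$ and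
    $B$. Both inlets of Tank 2 contribute $\xi_{T_2}p_{T_2}$, hence the factor 2 in the last row.
    The passage from scalar to vector derivatives is entrywise: [is_derive_mx] and
    [is_derive_col_of_seq]. *)

Lemma is_derive_mx (R : realFieldType) (V : normedModType R) (m n : nat)
    (M : V -> 'M[R]_(m, n)) (dM : 'M[R]_(m, n)) (t v : V) :
  (forall i j, is_derive t v (fun s => M s i j) (dM i j)) -> is_derive t v M dM.
Proof.
move=> dMij.
have Mtv : derivable M t v.
  by apply/derivable_mxP => i j; have [] := dMij i j.
split=> //; rewrite derive_mx//; apply/matrixP => i j; rewrite mxE.
by have [] := dMij i j.
Qed.

(** The state is written as a list of values at time [s]; recasting it as a list of functions
    evaluated at [s] lets each entry be differentiated alone. The size condition keeps every index
    in range, so the default [cst 0] is never reached. *)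
Lemma is_derive_col_of_seq (R : realFieldType) (V : normedModType R) (n : nat)
    (fs : seq (V -> R)) (df : 'cV[R]_n) (t v : V) :
  size fs = n ->
  (forall i : 'I_n, is_derive t v (nth (cst 0) fs i) (df i 0)) ->
  is_derive t v (fun s => col_of_seq n [seq f s | f <- fs]) df.
Proof.
move=> sz_fs dfs; apply: is_derive_mx => i j; rewrite ord1.
suff -> : (fun s => col_of_seq n [seq f s | f <- fs] i 0) = nth (cst 0) fs i.
  exact: dfs.
by apply/funext => s; rewrite mxE (nth_map (cst 0)) ?sz_fs.
Qed.

Theorem mainTheorem8 (R : realType) (D : set R)
  (Rs z0 T0 VT1 VT2 : R)
  (hRs : 0 < Rs) (hz0 : 0 < z0) (hT0 : 0 < T0)
  (hVT1 : 0 < VT1) (hVT2 : 0 < VT2)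
  (alphaT1 alphaT2 : R)
  (halphaT1 : alphaT1 = tank_alpha Rs z0 T0 VT1)
  (halphaT2 : alphaT2 = tank_alpha Rs z0 T0 VT2)
  (mT1 mT2 : R -> R -> R)
  (pT1bar pT1lbar pT2bar : R) (pT2lbar : 'I_2 -> R)
  (xiT1 zetaT1 xiT2 zetaT2 : R)
  (horT1 : orifice_coefficients mT1 pT1bar pT1lbar xiT1 zetaT1)
  (horT2 : forall i : 'I_2,
     orifice_coefficients mT2 pT2bar (pT2lbar i) xiT2 zetaT2)
  (alpha beta kappa gamma : 'I_2 -> R)
  (pT1 pT1l qT1l : R -> R) (qT1r : 'I_2 -> R -> R)
  (pl pr ql qr : 'I_2 -> R -> R)
  (pT2 qT2r : R -> R) (pT2l qT2l : 'I_2 -> R -> R)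
  (htank1 : tank1_model D alphaT1 xiT1 zetaT1 pT1 pT1l qT1l qT1r)
  (hmiddle : forall i : 'I_2,
     middle_section_model D (alpha i) (beta i) (kappa i) (gamma i)
       (pl i) (pr i) (ql i) (qr i))
  (htank2 : tank2_model D alphaT2 xiT2 zetaT2 pT2 qT2r pT2l qT2l)
  (hbc : manifold_boundary_conditions D pT1 qT1r pl pr ql qr pT2l qT2l) :
  let x : R -> 'cV[R]_6 := fun t =>
    col_of_seq 6 [:: pT1 t; pr sec1 t; ql sec1 t; pr sec2 t; ql sec2 t; pT2 t] in
  let y : R -> 'cV[R]_2 := fun t => col_of_seq 2 [:: pT2 t; qT1l t] in
  let u : R -> 'cV[R]_2 := fun t => col_of_seq 2 [:: pT1l t; qT2r t] in
  let A : 'M[R]_(6, 6) := mx_of_rows 6 6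
    [:: [:: alphaT1 * xiT1; 0; - alphaT1; 0; - alphaT1; 0];
        [:: 0; alpha sec1 * zetaT2; - alpha sec1; 0; 0; alpha sec1 * xiT2];
        [:: kappa sec1; beta sec1; gamma sec1; 0; 0; 0];
        [:: 0; 0; 0; alpha sec2 * zetaT2; - alpha sec2; alpha sec2 * xiT2];
        [:: kappa sec2; 0; 0; beta sec2; gamma sec2; 0];
        [:: 0; alphaT2 * zetaT2; 0; alphaT2 * zetaT2; 0; 2 * alphaT2 * xiT2]] in
  let B : 'M[R]_(6, 2) := mx_of_rows 6 2
    [:: [:: alphaT1 * zetaT1; 0];
        [:: 0; 0];
        [:: 0; 0];
        [:: 0; 0];
        [:: 0; 0];
        [:: 0; - alphaT2]] in
  let C : 'M[R]_(2, 6) := mx_of_rows 2 6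
    [:: [:: 0; 0; 0; 0; 0; 1];
        [:: xiT1; 0; 0; 0; 0; 0]] in
  let E : 'M[R]_(2, 2) := mx_of_rows 2 2
    [:: [:: 0; 0];
        [:: zetaT1; 0]] in
  forall t, D t ->
    is_derive t 1 x (A *m x t + B *m u t) /\ y t = C *m x t + E *m u t.
Proof.
move=> x y u A B C E t Dt.
have [dpT1 qT1lE] := htank1 t Dt.
have [dpT2 qT2lE] := htank2 t Dt.
have [dpr1 dql1] := hmiddle sec1 t Dt.
have [dpr2 dql2] := hmiddle sec2 t Dt.
have [pl1 qT1r1 pT2l1 qr1] := hbc t Dt sec1.
have [pl2 qT1r2 pT2l2 qr2] := hbc t Dt sec2.
(* The pressure upstream of each Tank 2 inlet becomes the state $p_{i,r}$. *)
have := qT2lE sec1; have := qT2lE sec2; rewrite pT2l1 pT2l2 => qT2l2 qT2l1.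
(* Output equation: its first row is trivial, its second is the orifice relation of Tank 1. *)
split; last first.
  apply/matrixP => i j; rewrite !mxE !big_ord_recl !big_ord0 !mxE /=.
  by case: i => [[|[|//]] ?] /=; rewrite ?qT1lE; ring.
apply: (@is_derive_col_of_seq _ _ _
  [:: pT1; pr sec1; ql sec1; pr sec2; ql sec2; pT2]) => // i.
(* In each row [is_derive_eq] takes the derivative from the model and leaves only its equality with
   that row of $Ax+Bu$. Flows $q_{i,r}$ are eliminated in two stages, first to $q_{T_2,i,\ell}$,
   then to $\xi_{T_2}p_{T_2}+\zeta_{T_2}p_{i,r}$. *)
case: i => [[|[|[|[|[|[|//]]]]]] ?] /=; [apply: is_derive_eq dpT1 _
  | apply: is_derive_eq dpr1 _ | apply: is_derive_eq dql1 _
  | apply: is_derive_eq dpr2 _ | apply: is_derive_eq dql2 _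
  | apply: is_derive_eq dpT2 _]; rewrite !mxE !big_ord_recl !big_ord0 !mxE /=
  ?qT1lE ?qT1r1 ?qT1r2 ?qr1 ?qr2 ?qT2l1 ?qT2l2 ?pl1 ?pl2; ring.
Qed.
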